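(* For any finite subset $K$ of $\mathbb Z^+$ with at least two elements, there are infinitely many values of $v$ for which there exists a harmonious S$(2,K,v)$.
   Context: A linear space S$(2,K,v)$ is a set of $v$ points with a family of blocks whose sizes lie in $K$, every element of $K$ occurring as a block size, such that every 2-subset of points lies in exactly one block. A resolution is a partition of the block set into parallel classes, each a partition of the point set. A harmonious S$(2,K,v)$ is a resolved S$(2,K,v)$ with an automorphism group (permutations of the points preserving the resolution) acting sharply transitively on the points and transitively on the parallel classes. *)

(* Defs.v *)
From mathcomp Require Import all_boot all_fingroup.
From mathcomp Require Import finmap.

Set Implicit Arguments.
Unset Strict Implicit.
Unset Printing Implicit Defensive.

(* A family of blocks is a multiset, given as a sequence considered up to
   perm_eq. Two points lie in a unique block, so only singleton blocks (which
   occur when 1 \in K) can be repeated; they can lie in several parallel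
   classes, each occurrence being a separate member of the family. *)
Definition linear_space (V : finType) (K : {fset nat}) (Bs : seq {set V}) : Prop :=
  [/\ (forall B, B \in Bs -> #|B| \in K),
      (forall k, k \in K -> exists2 B, B \in Bs & #|B| = k) &
      (forall e : {set V}, #|e| = 2 -> count (fun B : {set V} => e \subset B) Bs = 1)].

Definition parallel_class (V : finType) (C : {set {set V}}) : Prop :=
  partition C [set: V].

(* The blocks of the classes in R, put together, are exactly the blocks of Bs,
   counted with multiplicity. *)
Definition resolution (V : finType) (Bs : seq {set V}) (R : seq {set {set V}}) : Prop :=
  (forall C, C \in R -> parallel_class C) /\
  perm_eq (flatten [seq enum C | C : {set {set V}} <- R]) Bs.

Definition class_image (V : finType) (g : {perm V}) (C : {set {set V}}) : {set {set V}} :=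
  [set g @: B | B : {set V} in C].

Definition preserves_resolution (V : finType) (R : seq {set {set V}}) (g : {perm V}) : Prop :=
  perm_eq [seq class_image g C | C <- R] R.

Definition sharply_transitive (V : finType) (G : {group {perm V}}) : Prop :=
  forall x y : V, exists! g : {perm V}, g \in G /\ g x = y.

Definition transitive_on_classes (V : finType) (R : seq {set {set V}})
    (G : {group {perm V}}) : Prop :=
  forall C D, C \in R -> D \in R -> exists2 g, g \in G & class_image g C = D.

Definition harmonious (V : finType) (K : {fset nat}) (Bs : seq {set V})
    (R : seq {set {set V}}) : Prop :=
  [/\ linear_space K Bs, resolution Bs R &
      exists G : {group {perm V}},
        [/\ (forall g, g \in G -> preserves_resolution R g),
            sharply_transitive G & transitive_on_classes R G]].

Definition harmonious_exists (K : {fset nat}) (v : nat) : Prop :=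
  exists (V : finType) (Bs : seq {set V}) (R : seq {set {set V}}),
    #|V| = v /\ harmonious K Bs R.

(* Main.v *)
From HB Require Import structures.
Require Import Defs.
From mathcomp Require Import all_boot all_fingroup all_algebra all_solvable all_field.
From mathcomp Require Import finmap zify.
Set Implicit Arguments.
Unset Strict Implicit.
Unset Printing Implicit Defensive.

(* Let h be the least element of K and let H be cyclic of order h; the points
   are H x F for a finite field F, and the group is the group of translations.
   Let S be a subgroup of odd order and of index d in the multiplicative group
   of F. Suppose that base blocks, given by lists of pairs (a_l, b_l) in H x F,
   are such that all the b_l together form a transversal of S, and that, for
   every g in H, so do the differences b_l - b_l' within a block with
   a_l - a_l' = g. Then the sets {(a_l + x, s b_l) : l}, for s in S and x in H,
   together with H x {0}, form a partition of H x F whose translates by F are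
   the parallel classes of a harmonious linear space.

   For the H-components a_l of a block of size k all functions are used, which
   makes all types g of differences equally frequent; the numbers of blocks of
   each size are balanced so that every type occurs d times. It remains to
   choose the b_l so that they and their differences lie in prescribed cosets of
   S. Instead of Weil's bound this uses only a second moment estimate, which says
   that the differences of large subsets of F are equidistributed over the cosets
   of S, and a greedy choice. Finally d must have prescribed divisors while #|F|
   grows: take d = Q - 1 and #|F| = Q^k with k odd and Q a power of an odd
   prime. *)

(* Provides the missing finZmodType structure on products. *)
HB.saturate prod.

(** * Harmonious spaces from difference families *)

Section Translations.
Import GRing.Theory.
Local Open Scope ring_scope.
Variable V : finZmodType.

Definition transl (w : V) : {perm V} := perm (addIr w).

Lemma translE w u : transl w u = u + w.
Proof. exact: permE. Qed.

Definition transl_set : {set {perm V}} := [set transl w | w : V].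

Lemma transl_group_set : group_set transl_set.
Proof.
apply/group_setP; split.
  by apply/imsetP; exists 0 => //; apply/permP=> u; rewrite translE perm1 addr0.
move=> _ _ /imsetP[w _ ->] /imsetP[w' _ ->]; apply/imsetP; exists (w + w') => //.
by apply/permP=> u; rewrite permM !translE addrA.
Qed.

Canonical transl_group := Group transl_group_set.

Lemma transl_sharp : sharply_transitive transl_group.
Proof.
move=> x y; exists (transl (y - x)); split.
  by rewrite imset_f // translE addrC subrK.
move=> _ [/imsetP[w _ ->]]; rewrite translE => <-.
by congr transl; rewrite addrC addKr.
Qed.

End Translations.

Section Construction.
Import GRing.Theory.
Local Open Scope ring_scope.
Variables (H : finZmodType) (F : finFieldType) (J L : finType).
Variables (D : J -> {set L}) (S : {set F}) (a : J -> L -> H) (b : J -> L -> F).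

Hypothesis one_S : 1 \in S.
Hypothesis base_neq0 : forall j l s, l \in D j -> s \in S -> s * b j l != 0.
Hypothesis base_ex : forall z, z != 0 ->
  exists j l s, [/\ l \in D j, s \in S & s * b j l = z].
Hypothesis base_uniq : forall j l s j' l' s', l \in D j -> s \in S ->
  l' \in D j' -> s' \in S -> s * b j l = s' * b j' l' -> [/\ j = j', l = l' & s = s'].
Hypothesis diff_ex : forall g z, z != 0 ->
  exists j l l' s, [/\ l \in D j, l' \in D j, s \in S, a j l - a j l' = g
    & s * (b j l - b j l') = z].
Hypothesis diff_uniq : forall j l m s j' l' m' s',
  l \in D j -> m \in D j -> l != m -> s \in S ->
  l' \in D j' -> m' \in D j' -> l' != m' -> s' \in S ->
  a j l - a j m = a j' l' - a j' m' ->
  s * (b j l - b j m) = s' * (b j' l' - b j' m') ->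
  [/\ j = j', l = l', m = m' & s = s'].

Local Notation V := (H * F)%type.

Definition fiber (y : F) : {set V} := [set u | u.2 == y].

Definition block j s x y : {set V} :=
  [set ((a j l + x, s * b j l + y) : V) | l in D j].

Definition pclass (y : F) : {set {set V}} :=
  [set B | (B == fiber y) ||
     [exists j, exists s, exists x, (s \in S) && (B == block j s x y)]].

Lemma pclassP y (B : {set V}) :
  reflect (B = fiber y \/ exists j s x, s \in S /\ B = block j s x y)
          (B \in pclass y).
Proof.
rewrite inE; apply: (iffP orP) => -[].
- by move/eqP; left.
- move=> /existsP[j /existsP[s /existsP[x /andP[sS /eqP->]]]]; right.
  by exists j, s, x.
- by move->; left.
- move=> [j [s [x [sS ->]]]]; right.
  by apply/existsP; exists j; apply/existsP; exists s; apply/existsP; exists x;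
    rewrite sS eqxx.
Qed.

Lemma mem_block j s x y (u : V) :
  reflect (exists l, [/\ l \in D j, u.1 = a j l + x & u.2 = s * b j l + y])
          (u \in block j s x y).
Proof.
apply: (iffP imsetP) => [[l lD ->] | [l [lD u1 u2]]]; first by exists l.
by exists l => //; rewrite -u1 -u2 -surjective_pairing.
Qed.

Lemma block_coord_inj j s y : s \in S ->
  {in D j &, injective (fun l => s * b j l + y)}.
Proof.
move=> sS l l' lD lD' /addIr e; by case: (base_uniq lD sS lD' sS e).
Qed.

Lemma card_block j s x y : s \in S -> #|block j s x y| = #|D j|.
Proof.
move=> sS; apply: card_in_imset => l l' lD lD' [_ e].
exact: (block_coord_inj sS lD lD' e).
Qed.

Lemma card_fiber y : #|fiber y| = #|H|.
Proof.
rewrite -[RHS](card_imset (f := fun x : H => ((x, y) : V))); last by move=> x x' [].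
apply: eq_card => u; rewrite inE; apply/eqP/imsetP => [<-|[x _ ->] //].
by exists u.1 => //; rewrite -surjective_pairing.
Qed.

Lemma pclass_cover y u : exists2 B, B \in pclass y & u \in B.
Proof.
have [e|ne] := eqVneq u.2 y.
  by exists (fiber y); [apply/pclassP; left | rewrite inE e].
have [|j [l [s [lD sS e]]]] := @base_ex (u.2 - y); first by rewrite subr_eq0.
exists (block j s (u.1 - a j l) y).
  by apply/pclassP; right; exists j, s, (u.1 - a j l).
by apply/mem_block; exists l; rewrite e subrK addrC subrK.
Qed.

(** A block other than the fiber avoids the second coordinate [y], by [base_neq0]. For two such
    blocks through [u], the value [u.2 - y] determines [j], [l] and [s], and then [u.1] determines
    [x]. *)
Lemma pclass_disj y u B B' :
  B \in pclass y -> B' \in pclass y -> u \in B -> u \in B' -> B = B'.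
Proof.
have fib_block j s x : s \in S -> u \in block j s x y -> u.2 != y.
  move=> sS /mem_block[l [lD _ ->]].
  by rewrite -subr_eq0 addrK base_neq0.
move=> /pclassP[->|[j [s [x [sS ->]]]]] /pclassP[->|[j' [s' [x' [sS' ->]]]]] //.
- by rewrite inE => e /(fib_block _ _ _ sS'); rewrite e.
- by move=> /(fib_block _ _ _ sS) /negPf; rewrite inE => ->.
move=> /mem_block[l [lD u1 u2]] /mem_block[l' [lD' u1' u2']].
have [|ej el es] := base_uniq lD sS lD' sS'.
  by apply: (addIr y); rewrite -u2 -u2'.
subst; congr block; apply: (addrI (a j' l')); by rewrite -u1 -u1'.
Qed.

Lemma transl_fiber (w : V) y : transl w @: fiber y = fiber (y + w.2).
Proof.
apply/setP=> u; apply/imsetP/idP => [[v]|].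
  by rewrite !inE => /eqP <- ->; rewrite translE.
rewrite inE => /eqP e; exists (u - w); last by rewrite translE subrK.
by rewrite inE /= e addrK.
Qed.

Lemma transl_block (w : V) j s x y :
  transl w @: block j s x y = block j s (x + w.1) (y + w.2).
Proof.
rewrite -imset_comp; apply: eq_imset => l /=.
by rewrite translE /= !addrA.
Qed.

Lemma transl_pclass (w : V) y : class_image (transl w) (pclass y) = pclass (y + w.2).
Proof.
apply/setP=> B; apply/imsetP/pclassP => [[B' /pclassP[->|[j [s [x [sS ->]]]]] ->]|].
- by left; rewrite transl_fiber.
- by right; exists j, s, (x + w.1); rewrite transl_block.
- move=> [->|[j [s [x [sS ->]]]]].
    by exists (fiber y); [apply/pclassP; left | rewrite transl_fiber].
  exists (block j s (x - w.1) y); last by rewrite transl_block subrK.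
  by apply/pclassP; right; exists j, s, (x - w.1).
Qed.

(** Points with equal second coordinates meet only in a fiber, because inside any other block the
    second coordinate determines the slot. Otherwise [u - v] determines [j], [l], [m] and [s], and
    then [u] fixes [x] and the class index. *)
Lemma pair_pclass (u v : V) : u != v ->
  #|[set p : F * {set V} | (p.2 \in pclass p.1) && ([set u; v] \subset p.2)]| = 1%N.
Proof.
move=> uv.
have in_fiber y : u \in fiber y -> v \in fiber y -> u.2 = v.2.
  by rewrite !inE => /eqP-> /eqP->.
have in_block j s x y : s \in S -> u \in block j s x y -> v \in block j s x y ->
   exists l m, [/\ l \in D j, m \in D j, l != m, u.1 - v.1 = a j l - a j m
     & u.2 - v.2 = s * (b j l - b j m)] /\ [/\ x = u.1 - a j l & y = u.2 - s * b j l].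
  move=> sS /mem_block[l [lD u1 u2]] /mem_block[m [mD v1 v2]].
  exists l, m; rewrite u1 u2 v1 v2; split; split => //.
  - apply: contraNneq uv => e; subst m.
    by rewrite [u]surjective_pairing [v]surjective_pairing u1 u2 v1 v2.
  - by rewrite opprD addrACA subrr addr0.
  - by rewrite opprD addrACA subrr addr0 mulrBr.
  - by rewrite addrC addKr.
  - by rewrite addrC addKr.
have [e2|ne2] := eqVneq u.2 v.2.
  apply/eqP/cards1P; exists (u.2, fiber u.2); apply/setP=> -[y B].
  rewrite [LHS]inE [RHS]in_set1 /=; apply/idP/idP => [/andP[/pclassP BP]|/eqP[-> ->]].
    rewrite subUset !sub1set => /andP[uB vB].
    case: BP => [eB|[j [s [x [sS eB]]]]]; subst B.
      by move: uB; rewrite inE => /eqP->.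
    have [l [m [[lD mD lm _]]]] := in_block _ _ _ _ sS uB vB.
    rewrite e2 subrr => /esym/eqP.
    rewrite mulrBr subr_eq0 => /eqP e; case/negP: lm; apply/eqP.
    by case: (base_uniq lD sS mD sS e).
  apply/andP; split; first by apply/pclassP; left.
  by rewrite subUset !sub1set !inE e2 eqxx.
have ne2' : u.2 - v.2 != 0 by rewrite subr_eq0.
have [j [l [m [s [lD mD sS e1 e2]]]]] := diff_ex (u.1 - v.1) ne2'.
have lm : l != m by apply: contraNneq ne2' => e; rewrite -e2 e subrr mulr0.
apply/eqP/cards1P.
exists (u.2 - s * b j l, block j s (u.1 - a j l) (u.2 - s * b j l)).
apply/setP=> -[y B]; rewrite [LHS]inE [RHS]in_set1 /=; apply/idP/idP => [/andP[/pclassP BP]|/eqP[-> ->]].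
  rewrite subUset !sub1set => /andP[uB vB].
  case: BP => [eB|[j' [s' [x [sS' eB]]]]]; subst B.
    by case/eqP: ne2; apply: in_fiber uB vB.
  have [l' [m' [[lD' mD' lm' e1' e2'] [-> ->]]]] := in_block _ _ _ _ sS' uB vB.
  have [||-> -> _ ->] := diff_uniq lD mD lm sS lD' mD' lm' sS' => //.
  - by rewrite e1 e1'.
  - by rewrite e2 e2'.
apply/andP; split; first by apply/pclassP; right; exists j, s, (u.1 - a j l).
rewrite subUset !sub1set; apply/andP; split; apply/mem_block.
  by exists l; split=> //; rewrite addrC subrK.
exists m; split => //.
  have -> : u.1 = a j l - a j m + v.1 by rewrite e1 subrK.
  by rewrite addrAC [_ - a j l]addrAC subrr sub0r addNKr.
rewrite addrCA -mulrBr -opprB mulrN e2 opprB addrC subrK //.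
Qed.

Variable K : {fset nat}.
Hypothesis K_pos : forall k, k \in K -> (0 < k)%N.
Hypothesis H_K : #|H| \in K.
Hypothesis D_K : forall j, #|D j| \in K.
Hypothesis K_D : forall k, k \in K -> k = #|H| \/ exists j, #|D j| = k.

Lemma card_pclass_block y B : B \in pclass y -> #|B| \in K.
Proof.
by move=> /pclassP[->|[j [s [x [sS ->]]]]]; rewrite ?card_fiber ?card_block.
Qed.

Lemma partition_pclass y : parallel_class (pclass y).
Proof.
apply/and3P; split.
- rewrite eqEsubset subsetT; apply/subsetP=> u _; apply/bigcupP.
  by have [B] := pclass_cover y u; exists B.
- apply/trivIsetP=> B B' BP BP'; apply: contraR => /pred0Pn[u /andP[/= uB uB']].
  exact/eqP/(pclass_disj BP BP' uB uB').
- apply/negP=> /card_pclass_block/K_pos; by rewrite cards0.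
Qed.

Let R := [seq pclass y | y <- enum F].

(** Turns multiplicity in the multiset of blocks into a cardinality: a block lying in several
    classes counts once for each of them. *)
Lemma count_flatten_pclass (P : pred {set V}) :
  count P (flatten [seq enum (C : {set {set V}}) | C <- R]) =
  #|[set p : F * {set V} | (p.2 \in pclass p.1) && P p.2]|.
Proof.
rewrite count_flatten sumnE 3!big_map big_enum /=.
rewrite -sum1_card (eq_bigl (fun p : F * {set V} => true && ((p.2 \in pclass p.1) && P p.2)));
  last by move=> p; rewrite inE.
rewrite -(pair_big_dep xpredT (fun y B => (B \in pclass y) && P B) (fun _ _ => 1%N)) /=.
apply: eq_bigr => y _; by rewrite -big_enum_cond sum1_count.
Qed.

Theorem harmonious_construction : harmonious_exists K (#|H| * #|F|).
Proof.
exists V, (flatten [seq enum (C : {set {set V}}) | C <- R]), R.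
split; first by rewrite card_prod.
split.
- split.
  + move=> B /flattenP[_ /mapP[_ /mapP[y _ ->] ->]]; rewrite mem_enum.
    exact: card_pclass_block.
  + move=> k kK.
    have [B BP cB] : exists2 B, B \in pclass 0 & #|B| = k.
      case: (K_D kK) => [->|[j <-]].
        by exists (fiber 0); [apply/pclassP; left | exact: card_fiber].
      exists (block j 1 0 0); last exact: card_block.
      by apply/pclassP; right; exists j, 1, 0.
    exists B => //; apply/flattenP; exists (enum (pclass 0)); last by rewrite mem_enum.
    by apply/mapP; exists (pclass 0) => //; apply: map_f; rewrite mem_enum.
  + move=> e /eqP/cards2P[u [v [uv ->]]].
    by rewrite count_flatten_pclass pair_pclass.
- split=> // C /mapP[y _ ->]; exact: partition_pclass.
- exists (transl_group V); split; last 1 first.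
  + move=> _ _ /mapP[y _ ->] /mapP[y' _ ->]; exists (transl ((0, y' - y) : V)).
      exact: imset_f.
    by rewrite transl_pclass addrC subrK.
  + move=> _ /imsetP[w _ ->]; rewrite /preserves_resolution -map_comp.
    rewrite (eq_map (g := pclass \o (fun y => y + w.2))); last first.
      by move=> y /=; rewrite transl_pclass.
    (* Translation by [w] shifts the class indices by [w.2], which permutes the enumeration of
       [F]. *)
    rewrite map_comp; apply/perm_map/uniq_perm; last 2 first.
    * exact: enum_uniq.
    * move=> y; rewrite mem_enum; apply/mapP; exists (y - w.2); rewrite ?mem_enum //.
      by rewrite subrK.
    * by rewrite map_inj_uniq ?enum_uniq //; apply: addIr.
  + exact: transl_sharp.
Qed.

End Construction.

(** * Prescribed power residues of differences *)

Section PowerResidues.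
Import GRing.Theory.
Local Open Scope ring_scope.
Variables (F : finFieldType) (m d : nat).
Hypothesis m_odd : odd m.
Hypothesis cardF : #|F| = (m * d).+1.
Hypothesis d_gt0 : (0 < d)%N.

Let m_gt0 : (0 < m)%N.
Proof. by case: m m_odd. Qed.

(** The image of the nonzero elements under [x ^+ m]. The kernel of this power map is the subgroup S
    of order [m], so an element of [mu] stands for a coset of S. *)
Definition mu : {set F} := [set c | c ^+ d == 1].

Lemma card_power_fiber_le (k : nat) (c : F) : (0 < k)%N ->
  (#|[set x : F | x ^+ k == c]| <= k)%N.
Proof.
move=> k_gt0.
have sz : size ('X^k - c%:P) = k.+1 by exact: size_XnsubC.
rewrite cardE -ltnS -sz; apply: max_poly_roots.
- by rewrite -size_poly_eq0 sz.
- by apply/allP=> x; rewrite mem_enum inE rootE !hornerE subr_eq0.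
- exact: enum_uniq.
Qed.

Lemma power_mu x : x != 0 -> x ^+ m \in mu.
Proof.
move=> x0; rewrite inE -exprM; apply/eqP/(mulIf x0).
by rewrite -exprSr -cardF expf_card mul1r.
Qed.

Lemma mu_neq0 c : c \in mu -> c != 0.
Proof. by rewrite inE; apply: contraTneq => ->; rewrite expr0n gtn_eqF // eq_sym oner_eq0. Qed.

(** Counting roots bounds [mu] by [d] and each fiber by [m]. The fibers over [mu] exhaust the
    [m * d] nonzero elements, so all these bounds are attained. *)
Lemma card_mu_fibers : #|mu| = d /\ forall c, c \in mu -> #|[set x : F | x ^+ m == c]| = m.
Proof.
have le_mu : (#|mu| <= d)%N by apply: card_power_fiber_le.
have le_fib c : (#|[set x : F | x ^+ m == c]| <= m)%N by apply: card_power_fiber_le.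
have tot : (\sum_(c in mu) #|[set x : F | x ^+ m == c]| = m * d)%N.
  transitivity #|[set x : F | x != 0]|.
    rewrite -[RHS]sum1_card [RHS](partition_big (fun x => x ^+ m) (mem mu)); last first.
      by move=> x; rewrite [x \in _]inE; exact: power_mu.
    apply: eq_bigr => c cmu; rewrite -sum1_card; apply: eq_bigl => x.
    rewrite !inE; apply/idP/andP => [e|[]//]; split=> //.
    apply: contraTneq e => ->; rewrite expr0n gtn_eqF //= eq_sym.
    exact: mu_neq0.
  have := cardsC1 (0 : F); rewrite cardF /= => <-.
  by apply: eq_card => x; rewrite !inE.
have ub : (\sum_(c in mu) #|[set x : F | x ^+ m == c]| <= m * #|mu|)%N.
  by rewrite mulnC -sum_nat_const; apply: leq_sum.
have emu : #|mu| = d.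
  by apply/eqP; rewrite eqn_leq le_mu -(leq_pmul2l m_gt0) -tot.
split=> // c cmu.
have /(leqif_sum (P := mem mu)) H : forall c : F, c \in mu ->
  (#|[set x : F | x ^+ m == c]| <= m ?= iff (#|[set x : F | x ^+ m == c]| == m))%N.
  by move=> c' _; split.
have := H.2; rewrite tot sum_nat_const emu mulnC eqxx => /esym/forall_inP/(_ c cmu)/eqP //.
Qed.

Lemma power_opp (x : F) : (- x) ^+ m = - x ^+ m.
Proof. by rewrite exprNn -signr_odd m_odd expr1 mulN1r. Qed.

(** * Second moment of the residue counts *)

Section Variance.
Variable X : {set F}.

Definition residue_count (y c : F) : nat := #|[set x in X | (x != y) && ((x - y) ^+ m == c)]|.

(** First moment: each [x] in [X] is counted once from each of the [m * d] centers [y] other than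
    [x]. *)
Lemma sum_residue_count : (\sum_y \sum_(c in mu) residue_count y c = (m * d) * #|X|)%N.
Proof.
transitivity (\sum_y #|[set x in X | x != y]|)%N.
  apply: eq_bigr => y _.
  rewrite -[RHS]sum1_card [RHS](partition_big (fun x => (x - y) ^+ m) (mem mu)).
    apply: eq_bigr => c _; rewrite /residue_count -sum1_card; apply: eq_bigl => x.
    by rewrite !inE andbA.
  by move=> x; rewrite [x \in _]inE => /andP[_ xy]; apply: power_mu; rewrite subr_eq0.
under eq_bigr => y _ do rewrite -sum1_card big_mkcond.
rewrite exchange_big /= -[X in (_ = _ * X)%N]sum1_card big_distrr /= [RHS]big_mkcond.
apply: eq_bigr => x _; case: ifP => xX; last first.
  by rewrite big1 // => y _; rewrite inE xX.
rewrite -big_mkcond sum1_card muln1 -[RHS]/((m * d).+1.-1) -cardF -(cardsC1 x).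
by apply: eq_card => y; rewrite in_setC1 -[LHS]/(x \in [set x0 in X | x0 != y]) inE xX eq_sym.
Qed.

(* The ratio (x - y) / (x' - y) determines y, and it must be an m-th root of
   unity other than 1. *)
Lemma card_same_residue (x x' : F) : x != x' ->
  (#|[set y | [&& x != y, x' != y & (x - y) ^+ m == (x' - y) ^+ m]]| <= m.-1)%N.
Proof.
move=> xx'; set A := [set y | _].
pose f y := (x - y) / (x' - y).
have f1 y : f y - 1 = (x - x') / (x' - y) \/ x' = y.
  have [->|ne] := eqVneq x' y; first by right.
  left; rewrite /f -[X in _ - X](divff (x := x' - y)) ?subr_eq0 //.
  by rewrite -mulrBl opprB addrA subrK.
have inj : {in A &, injective f}.
  move=> y z; rewrite !inE => /and3P[_ y1 _] /and3P[_ z1 _] e.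
  have [ey|ey] := f1 y; last by rewrite ey eqxx in y1.
  have [ez|ez] := f1 z; last by rewrite ez eqxx in z1.
  move: ez; rewrite -e ey => /mulfI; rewrite subr_eq0 => /(_ xx')/invr_inj.
  by move/addrI/oppr_inj.
rewrite -(card_in_imset inj) -ltnS prednK //.
apply: (leq_trans _ (card_power_fiber_le 1 m_gt0)).
rewrite [in X in (_ < X)%N](cardsD1 1) inE expr1n eqxx ltnS.
apply/subset_leq_card/subsetP=> _ /imsetP[y yA ->].
move: yA; rewrite !inE => /and3P[xy xy' /eqP e].
rewrite /f expr_div_n e divff ?expf_neq0 ?subr_eq0 // eqxx andbT.
by rewrite -subr_eq0; case: (f1 y) => [->|/eqP]; [rewrite mulf_neq0 ?invr_eq0 ?subr_eq0 | rewrite (negPf xy')].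
Qed.

(** A square counts the pairs [x], [x'] of [X] that have residue [c] from [y]. A diagonal pair
    occurs for at most [m * d] centers, any other pair for at most [m.-1], by
    [card_same_residue]. *)
Lemma sum_sqr_residue_count :
  (\sum_y \sum_(c in mu) residue_count y c ^ 2 <= (m * d) * #|X| + #|X| * #|X|.-1 * m.-1)%N.
Proof.
have nbE y c : residue_count y c = (\sum_(x in X) ((x != y) && ((x - y) ^+ m == c)))%N.
  rewrite /residue_count -sum1_card big_mkcond [RHS]big_mkcond; apply: eq_bigr => x _.
  by rewrite inE; case: (x \in X) => //=; case: (_ && _).
have sqr_nb y c : (residue_count y c ^ 2 = \sum_(x in X) \sum_(x' in X)
   ((x != y) && ((x - y) ^+ m == c) && ((x' != y) && ((x' - y) ^+ m == c))))%N.
  rewrite expnS expn1 nbE big_distrl; apply: eq_bigr => x _ /=.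
  by rewrite big_distrr; apply: eq_bigr => x' _ /=; rewrite mulnb.
under eq_bigr => y _ do under eq_bigr => c _ do rewrite sqr_nb.
have step x x' : (\sum_y \sum_(c in mu)
   ((x != y) && ((x - y) ^+ m == c) && ((x' != y) && ((x' - y) ^+ m == c)) : nat)
   = #|[set y | [&& x != y, x' != y & (x - y) ^+ m == (x' - y) ^+ m]]|)%N.
  rewrite -[RHS]sum1_card [RHS]big_mkcond; apply: eq_bigr => y _; rewrite inE.
  have [->|xy] := eqVneq x y; first by rewrite big1 //= => c _; rewrite eqxx.
  rewrite (bigD1 ((x - y) ^+ m)) /=; last by rewrite power_mu ?subr_eq0.
  rewrite eqxx /= [X in (_ + X)%N]big1 ?addn0; last first.
    by move=> c /andP[_ /negPf ne]; rewrite eq_sym ne.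
  by rewrite (eq_sym ((x' - y) ^+ m)); case: (_ && _).
have -> : (\sum_y \sum_(c in mu) \sum_(x in X) \sum_(x' in X)
   ((x != y) && ((x - y) ^+ m == c) && ((x' != y) && ((x' - y) ^+ m == c)) : nat)
   = \sum_(x in X) \sum_(x' in X) #|[set y | [&& x != y, x' != y & (x - y) ^+ m == (x' - y) ^+ m]]|)%N.
  under eq_bigr => y _ do rewrite exchange_big /=.
  rewrite exchange_big /=; apply: eq_bigr => x _.
  under eq_bigr => y _ do rewrite exchange_big /=.
  rewrite exchange_big /=; apply: eq_bigr => x' _; exact: step.
have bound x : x \in X -> (\sum_(x' in X)
   #|[set y | [&& x != y, x' != y & (x - y) ^+ m == (x' - y) ^+ m]]|
   <= m * d + #|X|.-1 * m.-1)%N.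
  move=> xX; rewrite (bigD1 x) //=; apply: leq_add.
    rewrite -[X in (_ <= X)%N]/((m * d).+1.-1) -cardF -(cardsC1 x).
    apply/subset_leq_card/subsetP=> y; rewrite !inE => /and3P[+ _ _].
    by rewrite eq_sym.
  have -> : #|X|.-1 = #|[set x' in X | x' != x]|.
    rewrite (cardsD1 x X) xX /=; apply: eq_card => x'; by rewrite !inE andbC.
  rewrite -sum_nat_const; rewrite [X in (_ <= X)%N](eq_bigl (fun x' => (x' \in X) && (x' != x))).
    by apply: leq_sum => x' /andP[_ ne]; apply: card_same_residue; rewrite eq_sym.
  by move=> x'; rewrite inE.
apply: leq_trans (leq_sum _ bound) _.
by rewrite sum_nat_const mulnDr (mulnC #|X| (m * d)%N) mulnA.
Qed.

(* Chebyshev: the previous bound says that the sum over y and c of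
   (d * residue_count y c - #|X|)^2 is at most of order d^2 #|F| #|X|. *)
Lemma card_poor_centers c : c \in mu ->
  (#|[set y | 2 * d * residue_count y c < #|X|]| * #|X| <= 4 * d ^ 2 * #|F|)%N.
Proof.
move=> cmu; set Y := [set y | _].
have [->|X_gt0] := posnP #|X|; first by rewrite muln0.
(* This is [4 (x - t)^2 >= x^2] when [2 t < x], and [>= 0] otherwise, expanded to avoid subtraction;
   it is applied to [t = d * residue_count y c'] and [x = #|X|]. *)
have sqr_dev t x : (8 * t * x + (2 * t < x) * x ^ 2 <= 4 * t ^ 2 + 4 * x ^ 2)%N.
  case: ltnP => [tx|_].
    by have [r ->] : exists r, x = (2 * t + r)%N; [exists (x - 2 * t)%N; lia | nia].
  by have := (nat_Cauchy t x).1; lia.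
have pointwise y c' : (8 * d * residue_count y c' * #|X| + ((y \in Y) && (c' == c)) * #|X| ^ 2
    <= 4 * d ^ 2 * residue_count y c' ^ 2 + 4 * #|X| ^ 2)%N.
  have := sqr_dev (d * residue_count y c')%N #|X|; rewrite inE expnMn !mulnA.
  by case: eqP => [->|_]; [rewrite andbT | rewrite andbF; lia].
have total : (8 * d * (m * d * #|X|) * #|X| + #|Y| * #|X| ^ 2
    <= 4 * d ^ 2 * (m * d * #|X| + #|X| * #|X|.-1 * m.-1)
       + #|F| * (d * (4 * #|X| ^ 2)))%N.
  have : (\sum_y \sum_(c' in mu)
      (8 * d * residue_count y c' * #|X| + ((y \in Y) && (c' == c)) * #|X| ^ 2)
    <= \sum_(y : F) \sum_(c' in mu) (4 * d ^ 2 * residue_count y c' ^ 2 + 4 * #|X| ^ 2))%N.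
    by apply: leq_sum => y _; apply: leq_sum.
  under eq_bigr => y _ do rewrite big_split -big_distrl -big_distrr /=.
  rewrite big_split -big_distrl -big_distrr /= sum_residue_count.
  under [X in (_ <= X)%N -> _]eq_bigr => y _ do rewrite big_split -big_distrr sum_nat_const /=.
  rewrite big_split -big_distrr sum_nat_const /= card_mu_fibers.1 => le1.
  have cardY : (\sum_y \sum_(c' in mu) ((y \in Y) && (c' == c)) * #|X| ^ 2 = #|Y| * #|X| ^ 2)%N.
    rewrite -sum_nat_const [RHS]big_mkcond; apply: eq_bigr => y _.
    rewrite (bigD1 c cmu) /= eqxx andbT big1 ?addn0; last first.
      by move=> c' /andP[_ /negPf->]; rewrite andbF.
    by case: (y \in Y); rewrite ?mul1n.
  rewrite -cardY; apply: leq_trans le1 _; rewrite leq_add2r leq_mul2l.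
  by apply/orP; right; apply: sum_sqr_residue_count.
rewrite -(leq_pmul2r X_gt0).
move: total; rewrite cardF.
move: (#|Y|) (#|X|) X_gt0 m_gt0 d_gt0 => Y' [//|x] _; case: (m) => // m' _; case: (d) => // d' _ /=.
nia.
Qed.
End Variance.

(** Union bound, removing the bad sets from [X] one at a time. *)
Lemma avoid_sets (T : finType) (P : eqType) (B : P -> {set T}) (M : nat) s (X : {set T}) :
  (forall j, j \in s -> #|B j| <= M)%N -> (size s * M < #|X|)%N ->
  exists2 x, x \in X & forall j, j \in s -> x \notin B j.
Proof.
elim: s X => [|i s IHs] X leB ltX.
  have /set0Pn[x xX] : X != set0 by rewrite -card_gt0; lia.
  by exists x.
have [||x] := IHs (X :\: B i).
- by move=> j js; apply: leB; rewrite inE js orbT.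
- have := cardsID (B i) X; have := subset_leq_card (subsetIr X (B i)).
  have := leB i (mem_head _ _); move: ltX => /=; nia.
rewrite inE => /andP[xBi xX] xB; exists x => // j; rewrite inE => /predU1P[->//|].
exact: xB.
Qed.

(* Greedy choice: the next value avoids the poor centers of all the candidate
   sets that remain, so that each of these shrinks by a factor 2d at most. *)
Lemma embed_residues (P : eqType) (E : rel P) (e : P -> P -> F)
  (e_mu : forall i j, e i j \in mu) (e_opp : forall i j, E i j -> e j i = - e i j)
  s (A : nat) (X : P -> {set F}) :
  uniq s -> (forall j, j \in s -> #|F| <= A * #|X j|)%N ->
  (size s * (4 * d ^ 2) * ((2 * d) ^ size s * A) ^ 2 < #|F|)%N ->
  exists b : P -> F, (forall i, i \in s -> b i \in X i) /\
    {in s &, forall i j, i != j -> E i j -> (b i - b j) ^+ m = e i j}.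
Proof.
elim: s A X => [|i s IHs] A X; first by exists (fun=> 0).
rewrite cons_uniq => /andP[iNs us] leX big.
pose poor j := [set y | (2 * d * residue_count (X j) y (e j i) < #|X j|)%N].
have F_gt0 : (0 < #|F|)%N by rewrite cardF.
have exp_gt0 k : (0 < (2 * d) ^ k)%N by rewrite expn_gt0 muln_gt0 d_gt0.
have le_poor j : j \in s -> (#|poor j| <= 4 * d ^ 2 * A)%N.
  move=> js; have := card_poor_centers (X j) (e_mu j i); rewrite -/(poor j) => le1.
  rewrite -(leq_pmul2r F_gt0); apply: leq_trans (leq_mul (leqnn _) (leX j _)) _.
    by rewrite inE js orbT.
  by rewrite mulnCA mulnAC [leqRHS]mulnC leq_mul2l le1 orbT.
have [x xX x_rich] : exists2 x, x \in X i & forall j, j \in s -> x \notin poor j.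
  (* Otherwise [#|F| <= A * #|X i| <= size s * 4 d^2 A^2], against [big]. *)
  apply: (avoid_sets le_poor); rewrite ltnNge; apply/negP=> leXi.
  have := leX i (mem_head _ _); rewrite leqNgt => /negP; apply.
  apply: leq_ltn_trans big; apply: leq_trans (leq_mul (leqnn A) leXi) _.
  have : (A <= (2 * d) ^ size (i :: s) * A)%N by rewrite leq_pmull.
  move: ((2 * d) ^ _ * A)%N => A' leA /=.
  have : (A * A <= A' * A')%N by apply: leq_mul.
  by nia.
pose X' j := [set y in X j | (y != x) && ((y - x) ^+ m == e j i)].
(* As [x] is not poor, the inverse density bound [A] becomes [2 * d * A]; the shorter list gives
   back one power of [2 * d], so the size condition persists. *)
have [||b [bX bE]] := IHs (2 * d * A)%N X' us.
- move=> j js; have := x_rich j js; rewrite inE -leqNgt => rich.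
  apply: leq_trans (leX j _) _; first by rewrite inE js orbT.
  by rewrite mulnC -mulnA [(A * _)%N]mulnC mulnA leq_mul2r rich orbT.
- apply: leq_ltn_trans big; rewrite [((2 * d) ^ _ * (2 * d * A))%N]mulnA -expnSr /=.
  by rewrite leq_mul2r leq_mul2r leqnSn !orbT.
exists (fun j => if j == i then x else b j); split.
  move=> j; rewrite inE; case: eqP => [->|_] //= /bX.
  by rewrite inE => /andP[].
have bx j : j \in s -> (b j - x) ^+ m = e j i.
  by move=> /bX; rewrite inE => /and3P[_ _ /eqP].
move=> j k; rewrite !inE; case: (eqVneq j i) => [->|_]; case: (eqVneq k i) => [->|_] //=.
(* The reversed difference has the negated residue because [m] is odd, in agreement with [e_opp]. *)
- by move=> _ ks _ Eik; rewrite -opprB power_opp bx // (e_opp _ _ Eik) opprK.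
- by move=> js _ _ _; apply: bx.
- exact: bE.
Qed.
End PowerResidues.

(** * Bijections between finite sets, and fields of prescribed index *)

Lemma card_bijection (T T' : finType) (A : {set T}) (B : {set T'}) :
  #|A| = #|B| -> 0 < #|B| ->
  exists f : T -> T', [/\ forall x, f x \in B, {in A &, injective f}
    & forall y, y \in B -> exists2 x, x \in A & f x = y].
Proof.
move=> eAB B_gt0; have /card_gt0P[x0 x0B] := B_gt0.
have /card_gt0P[x xA] : 0 < #|A| by rewrite eAB.
have sz : size (enum A) = size (enum B) by rewrite -!cardE.
(* The default [x0] lies in [B], so the map sends points outside [A] into [B] as well. *)
exists (fun x => nth x0 (enum B) (index x (enum A))); split.
- move=> z; have [lt|le] := ltnP (index z (enum A)) (size (enum B)).
    by have := mem_nth x0 lt; rewrite mem_enum.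
  by rewrite nth_default.
- move=> z y zA yA /eqP; rewrite nth_uniq ?enum_uniq -?sz ?index_mem ?mem_enum //.
  move=> /eqP e; rewrite -[z](nth_index x (s := enum A)) ?mem_enum // e.
  by rewrite nth_index ?mem_enum.
- move=> y yB; have lt : index y (enum B) < size (enum A) by rewrite sz index_mem mem_enum.
  exists (nth x (enum A) (index y (enum B))); first by rewrite -mem_enum mem_nth.
  by rewrite index_uniq ?enum_uniq // nth_index // mem_enum.
Qed.

(** By Euler's theorem [d0] divides [Q - 1] for [Q = p ^ totient d0]. The index [d = Q - 1] is fixed
    before [N]; only the exponent [k] in [#|F| = Q ^ k] grows, with
    [m = 1 + Q + ... + Q ^ (k - 1)]. *)
Lemma field_with_odd_index (d0 : nat) : 0 < d0 ->
  exists d, [/\ d0 %| d, ~~ odd d, 0 < d &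
    forall N, exists (F : finFieldType) (m : nat),
      [/\ odd m, #|F| = (m * d).+1, (2%:R != 0 :> F)%R & N < #|F|]].
Proof.
(* A prime above [d0 + 2] is odd and coprime to [d0]. *)
move=> d0_gt0; have [p lt_p pr_p] := prime_above (d0 + 2).
have p_odd : odd p by case/even_prime: pr_p lt_p => // ->; lia.
have t_gt0 : 0 < totient d0 by rewrite totient_gt0.
pose Q := p ^ totient d0.
have Q_odd : odd Q by rewrite oddX p_odd orbT.
have Q_gt1 : 1 < Q by rewrite -(expn0 p) ltn_exp2l // prime_gt1.
have co : coprime p d0.
  by rewrite prime_coprime //; apply/negP=> /(dvdn_leq d0_gt0); lia.
exists Q.-1; split.
- by have /eqP := Euler_exp_totient co; rewrite eqn_mod_dvd ?subn1 //; apply: ltnW.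
- by move: Q_odd Q_gt1; case: (Q) => //=.
- by rewrite -ltnS prednK ?(ltnW Q_gt1).
(* An odd number of odd summands makes [m] odd, and [k > N] makes [Q ^ k > N]. *)
move=> N; pose k := (2 * N).+1.
have tk_gt0 : 0 < totient d0 * k by rewrite muln_gt0 t_gt0.
have [F pF cF] := pPrimePowerField pr_p tk_gt0.
exists F, (\sum_(i < k) Q ^ i); split.
- have odd_sum j : odd (\sum_(i < j) Q ^ i) = odd j.
    by elim: j => [|j IHj]; rewrite ?big_ord0 // big_ord_recr /= oddD IHj oddX Q_odd orbT addbT.
  by rewrite odd_sum /= oddM.
- by rewrite cF expnM -/Q mulnC -predn_exp prednK // expn_gt0 ltnW.
- by rewrite -(GRing.dvdn_pcharf pF); apply/negP=> /dvdn_leq; lia.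
- rewrite cF expnM -/Q; apply: leq_trans (ltn_expl _ Q_gt1); lia.
Qed.

Lemma card_set_pair (T1 T2 : finType) (A : {set T1 * T2}) :
  #|A| = \sum_x #|[set y | (x, y) \in A]|.
Proof.
rewrite -sum1_card (eq_bigl (fun p => true && ((p.1, p.2) \in A))); last by case.
rewrite -(pair_big_dep xpredT (fun x y => (x, y) \in A) (fun _ _ => 1)) /=.
by apply: eq_bigr => x _; rewrite -sum1_card; apply: eq_bigl => y; rewrite inE.
Qed.

(** * Patterns with uniform differences *)

Section Patterns.
Import GRing.Theory.
Local Open Scope ring_scope.
Variables (H : finZmodType) (I : finType) (kappa : I -> nat) (n : nat).
Hypothesis kappa_le : forall i, (kappa i <= n)%N.
Local Notation J := (I * {ffun 'I_n -> H})%type.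

(** The functions in [J] live on all of ['I_n], so that every [i] has the same number [#|H| ^ n] of
    copies; only the first [kappa i] values form the block. *)
Definition slots (j : J) : {set 'I_n} := [set l : 'I_n | (l < kappa j.1)%N].
Definition points : {set J * 'I_n} := [set p | p.2 \in slots p.1].
(** Only increasing pairs are listed; the reversed ones are obtained by negating differences and
    residues. *)
Definition pairs : {set J * ('I_n * 'I_n)} :=
  [set u : J * ('I_n * 'I_n) | (u.2.1 < u.2.2 < kappa u.1.1)%N].
Definition pairs_of_type (g : H) := [set u in pairs | u.1.2 u.2.1 - u.1.2 u.2.2 == g].

Lemma card_slots j : #|slots j| = kappa j.1.
Proof.
rewrite -sum1_card; rewrite (eq_bigl (fun l : 'I_n => (l < kappa j.1)%N)); last first.
  by move=> l; rewrite inE.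
by rewrite -(big_ord_widen n (fun=> 1%N)) ?kappa_le // sum1_card card_ord.
Qed.

Lemma sum_pattern (f : I -> nat) : (\sum_(j : J) f j.1 = #|H| ^ n * \sum_i f i)%N.
Proof.
rewrite -(pair_bigA _ (fun i (_ : {ffun 'I_n -> H}) => f i)) big_distrr /=.
by apply: eq_bigr => i _; rewrite sum_nat_const card_ffun card_ord.
Qed.

Lemma card_points : #|points| = (#|H| ^ n * \sum_i kappa i)%N.
Proof.
rewrite card_set_pair -sum_pattern; apply: eq_bigr => j _.
by rewrite -card_slots; apply: eq_card => l; rewrite !inE.
Qed.

Lemma card_pairs : (#|pairs| * 2 = #|H| ^ n * \sum_i kappa i * (kappa i).-1)%N.
Proof.
have gauss k : ((\sum_(l < k) l) * 2 = k * k.-1)%N.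
  by elim: k => [|k IHk]; rewrite ?big_ord0 // big_ord_recr /= mulnDl IHk; case: (k) => //=; lia.
rewrite card_set_pair -sum_pattern big_distrl /=; apply: eq_bigr => j _.
rewrite -gauss (big_ord_widen n (fun l => l)) ?kappa_le //; congr (_ * 2)%N.
rewrite card_set_pair [RHS]big_mkcond /=.
under eq_bigr => l _ do rewrite -sum1_card big_mkcond /=.
rewrite exchange_big /=; apply: eq_bigr => l' _; case: ifP => lt; last first.
  by rewrite big1 // => l _; rewrite !inE /= lt andbF.
rewrite -big_mkcond (eq_bigl (fun l : 'I_n => (l < l')%N)) /=.
  by rewrite -(big_ord_widen n (fun=> 1%N)) ?sum1_card ?card_ord // ltnW.
by move=> l; rewrite !inE /= lt andbT.
Qed.

(* Translating the value at the smaller point turns pairs of one type into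
   pairs of another. *)
Lemma card_pairs_of_type g : (#|H| * #|pairs_of_type g| = #|pairs|)%N.
Proof.
have le_type g1 g2 : (#|pairs_of_type g1| <= #|pairs_of_type g2|)%N.
  pose sh (u : J * ('I_n * 'I_n)) : J * ('I_n * 'I_n) := ((u.1.1,
    [ffun x => u.1.2 x + (if x == u.2.1 then g2 - g1 else 0)]), u.2).
  have sh_inj : injective sh.
    move=> [[i a] [l l']] [[i' a'] [k k']] [<- ea ek ek']; subst k k'; congr (_, _, _).
    by apply/ffunP=> x; have /ffunP/(_ x) := ea; rewrite !ffunE => /addIr.
  rewrite -(card_imset _ sh_inj); apply/subset_leq_card/subsetP=> _ /imsetP[u uP ->].
  move: uP; rewrite !inE /= => /andP[/andP[lt lt'] /eqP e]; rewrite lt lt' /= !ffunE eqxx.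
  rewrite [u.2.2 == _]eq_sym (_ : (u.2.1 == u.2.2) = false) ?addr0; last first.
    by apply/negbTE; rewrite neq_ltn lt.
  by rewrite addrAC e addrC subrK.
have eq_type g' : #|pairs_of_type g'| = #|pairs_of_type g|.
  by apply/eqP; rewrite eqn_leq !le_type.
rewrite -[RHS]sum1_card (partition_big (fun u : J * ('I_n * 'I_n) => u.1.2 u.2.1 - u.1.2 u.2.2) xpredT) //=.
rewrite (eq_bigr (fun=> #|pairs_of_type g|)); first by rewrite sum_nat_const.
move=> g' _; rewrite -(eq_type g') -sum1_card; apply: eq_bigl => u.
by rewrite [RHS]inE.
Qed.

End Patterns.

(** * Representatives of the roots of unity up to sign *)

Section Halves.
Import GRing.Theory.
Local Open Scope ring_scope.
Variables (F : finFieldType) (m d : nat).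
Hypothesis m_odd : odd m.
Hypothesis d_even : ~~ odd d.
Hypothesis d_gt0 : (0 < d)%N.
Hypothesis cardF : #|F| = (m * d).+1.
Hypothesis two_neq0 : 2%:R != 0 :> F.

Lemma mu_opp c : (- c \in mu F d) = (c \in mu F d).
Proof. by rewrite !inE exprNn -signr_odd (negPf d_even) mul1r. Qed.

(** Negation acts on [mu] because [d] is even, and without fixed points because 2 is nonzero in [F].
    From each pair [c], [- c] the element of smaller rank is kept. *)
Lemma mu_half : exists h : {set F}, [/\ (#|h| * 2 = d)%N, h \subset mu F d
  & forall c, c \in mu F d -> (- c \in h) = (c \notin h)].
Proof.
have ne_opp c : c \in mu F d -> c != - c.
  move=> cmu; rewrite -subr_eq0 opprK -mulr2n -mulr_natr mulf_neq0 //.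
  exact: mu_neq0 cmu.
pose h := [set c in mu F d | (enum_rank c < enum_rank (- c))%N].
have hN c : c \in mu F d -> (- c \in h) = (c \notin h).
  move=> cmu; rewrite [- c \in h]in_set [c \in h]in_set mu_opp cmu /= opprK -leqNgt ltn_neqAle.
  have /negPf-> // : (enum_rank (- c) != enum_rank c :> nat).
  by rewrite (inj_eq val_inj) (inj_eq enum_rank_inj) eq_sym ne_opp.
exists h; split => //; last by apply/subsetP=> c; rewrite [c \in h]inE => /andP[].
have [<- _] := card_mu_fibers m_odd cardF d_gt0.
have sub : h \subset mu F d by apply/subsetP=> c; rewrite [c \in h]inE => /andP[].
rewrite -(cardsID h (mu F d)) (setIidPr sub) muln2 -addnn; congr addn.
rewrite -(card_imset _ (@oppr_inj F)); apply: eq_card => c; apply/imsetP/idP => [[x xh ->]|].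
  have xmu := subsetP sub _ xh.
  by rewrite in_setD mu_opp xmu hN // xh.
rewrite in_setD => /andP[ch cmu]; exists (- c); rewrite ?opprK //.
by rewrite hN.
Qed.

End Halves.

(** * The difference family *)

Section Assembly.
Import GRing.Theory.
Local Open Scope ring_scope.
Variables (H : finZmodType) (I : finType) (kappa : I -> nat) (n : nat).
Hypothesis kappa_le : forall i, (kappa i <= n)%N.
Variables (F : finFieldType) (m d : nat).
Hypothesis m_odd : odd m.
Hypothesis d_even : ~~ odd d.
Hypothesis d_gt0 : (0 < d)%N.
Hypothesis cardF : #|F| = (m * d).+1.
Hypothesis two_neq0 : 2%:R != 0 :> F.
Hypothesis F_big : (d * (4 * d ^ 2) * ((2 * d) ^ d * (2 * d)) ^ 2 < #|F|)%N.
Hypothesis size_points : (#|H| ^ n * \sum_i kappa i = d)%N.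
Hypothesis size_pairs :
  (\sum_i kappa i * (kappa i).-1 = #|H| * \sum_i kappa i)%N.

Local Notation J := (I * {ffun 'I_n -> H})%type.
Local Notation pts := (points H kappa n).

(** There are [d] points and, by [size_pairs], [d / 2] increasing pairs of each type. Bijections of
    the points with [mu] and of the increasing pairs of each type with [h] prescribe the residues,
    which [embed_residues] realizes. Reversed pairs of type [- g] supply the other half of [mu] for
    type [g]. *)
Lemma pattern_embedding : exists b : J -> 'I_n -> F,
  [/\ forall z, z != 0 -> exists j l, l \in slots kappa j /\ b j l ^+ m = z ^+ m,
      forall j l, l \in slots kappa j -> b j l != 0,
      forall j l j' l', l \in slots kappa j -> l' \in slots kappa j' ->
        b j l ^+ m = b j' l' ^+ m -> j = j' /\ l = l',
      forall g z, z != 0 -> exists j l l', [/\ l \in slots kappa j, l' \in slots kappa j,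
        l != l', j.2 l - j.2 l' = g & (b j l - b j l') ^+ m = z ^+ m]
    & forall j l k j' l' k', l \in slots kappa j -> k \in slots kappa j -> l != k ->
        l' \in slots kappa j' -> k' \in slots kappa j' -> l' != k' ->
        j.2 l - j.2 k = j'.2 l' - j'.2 k' ->
        (b j l - b j k) ^+ m = (b j' l' - b j' k') ^+ m -> [/\ j = j', l = l' & k = k']].
Proof.
have m_gt0 : (0 < m)%N by case: m m_odd.
have [card_mu card_fib] := card_mu_fibers m_odd cardF d_gt0.
have [h [card_h h_mu hN]] := mu_half m_odd d_even d_gt0 cardF two_neq0.
have muP z : z != 0 -> z ^+ m \in mu F d by apply: power_mu.
have card_pts : #|pts| = d by rewrite card_points.
have [c [c_mu c_inj c_onto]] : exists c : J * 'I_n -> F, [/\ forall x, c x \in mu F d,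
    {in pts &, injective c} & forall y, y \in mu F d -> exists2 x, x \in pts & c x = y].
  by apply: card_bijection; rewrite card_mu.
have /fin_all_exists[f fP] : forall g : H, exists f : J * ('I_n * 'I_n) -> F,
  [/\ forall x, f x \in h, {in pairs_of_type kappa n g &, injective f}
    & forall y, y \in h -> exists2 x, x \in pairs_of_type kappa n g & f x = y].
  move=> g; apply: card_bijection; last by lia.
  have H_gt0 : (0 < #|H|)%N by apply/card_gt0P; exists 0.
  apply/eqP; rewrite -(eqn_pmul2l H_gt0) card_pairs_of_type.
  rewrite -(@eqn_pmul2r 2) // -mulnA card_h card_pairs // size_pairs.
  by rewrite -size_points mulnCA.
have f_h g x : f g x \in h by case: (fP g).
pose e (p q : J * 'I_n) := if (p.2 < q.2)%N then f (p.1.2 p.2 - p.1.2 q.2) (p.1, (p.2, q.2))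
  else - f (p.1.2 q.2 - p.1.2 p.2) (p.1, (q.2, p.2)).
(* Only differences within one block are prescribed. *)
pose E (p q : J * 'I_n) := (p.1 == q.1) && (p.2 != q.2).
have e_mu p q : e p q \in mu F d.
  by rewrite /e; case: ifP => _; rewrite ?mu_opp //; apply: (subsetP h_mu).
have e_opp p q : E p q -> e q p = - e p q.
  case: p q => [j l] [j' l'] /andP[/eqP/= <- ne].
  by rewrite /e /=; case: (ltngtP l l') ne => [||/val_inj->]; rewrite ?opprK ?eqxx.
have [||b [bX bE]] := embed_residues m_odd cardF d_gt0 e_mu e_opp
    (A := 2 * d) (X := fun p => [set x | x ^+ m == c p]) (enum_uniq pts).
(* A fiber has [m] elements and [m * d + 1 <= 2 * d * m], whence the choice [A = 2 * d]. *)
- move=> p _; rewrite card_fib // cardF; nia.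
- by rewrite -cardE card_pts.
have b_chi j l : l \in slots kappa j -> b (j, l) ^+ m = c (j, l).
  move=> lj; have := bX (j, l); rewrite mem_enum !inE => H0.
  by apply/eqP/H0; rewrite inE in lj.
have b_diff j l l' : l \in slots kappa j -> l' \in slots kappa j -> l != l' ->
    (b (j, l) - b (j, l')) ^+ m = e (j, l) (j, l').
  move=> lj lj' ne; apply: bE; rewrite ?mem_enum ?[_ \in points _ _ _]inE //.
    by rewrite xpair_eqE eqxx.
  by rewrite /E /= eqxx.
exists (fun j l => b (j, l)); split.
- move=> z /muP/c_onto[[j l]]; rewrite inE => lj <-.
  by exists j, l; rewrite b_chi.
- move=> j l lj; apply/eqP=> b0; have := c_mu (j, l).
  by rewrite -b_chi // b0 => /(mu_neq0 d_gt0); rewrite expr0n gtn_eqF ?eqxx.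
- move=> j l j' l' lj lj'; rewrite !b_chi // => /c_inj.
  have ptsE i x : ((i, x) \in pts) = (x \in slots kappa i) by rewrite inE.
  by rewrite !ptsE => /(_ lj lj')[-> ->].
- move=> g z z0; have zmu := muP z z0.
  have split_type g' u : u \in pairs_of_type kappa n g' -> [/\ u.2.1 \in slots kappa u.1,
      u.2.2 \in slots kappa u.1, (u.2.1 < u.2.2)%N, u.2.1 != u.2.2 & u.1.2 u.2.1 - u.1.2 u.2.2 = g'].
    rewrite !inE => /andP[/andP[lt lt'] /eqP eg]; split=> //; first exact: ltn_trans lt'.
    by rewrite -val_eqE ltn_eqF.
  have [zh|zh] := boolP (z ^+ m \in h).
    have [_ _ /(_ _ zh)[u /split_type[u1 u2 lt ne eg] fu]] := fP g.
    by exists u.1, u.2.1, u.2.2; split=> //; rewrite b_diff // /e /= lt eg -fu; case: (u) => ? [].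
  (* A residue outside [h] is the negative of one in [h], found on an increasing pair of type [- g]
     and read backwards. *)
  rewrite -hN // in zh.
  have [_ _ /(_ _ zh)[u /split_type[u1 u2 lt ne eg] fu]] := fP (- g).
  exists u.1, u.2.2, u.2.1; split=> //; first by rewrite eq_sym.
    by rewrite -opprB eg opprK.
  rewrite b_diff // 1?eq_sym // /e /= ltnNge (ltnW lt) /= eg.
  by rewrite -[RHS]opprK -fu; case: (u) => ? [].
- move=> j l k j' l' k' lj kj ne lj' kj' ne' eg; rewrite !b_diff // /e /=.
  have in_type i x y : x \in slots kappa i -> y \in slots kappa i -> (x < y)%N ->
      (i, (x, y)) \in pairs_of_type kappa n (i.2 x - i.2 y).
    by move=> xi yi lt; rewrite !inE /= eqxx lt andbT; rewrite inE in yi.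
  (* An increasing and a decreasing pair never share a residue: one lies in [h], the other
     outside. *)
  have not_opp g x g' x' : f g x <> - f g' x'.
    move=> ef; have := hN _ (subsetP h_mu _ (f_h g' x')).
    by rewrite -ef !f_h.
  case: (ltngtP l k) ne => [lt _|lt _|/val_inj->]; last by rewrite eqxx.
    case: (ltngtP l' k') ne' => [lt' _|lt' _|/val_inj->]; last by rewrite eqxx.
      have [_ f_inj _] := fP (j.2 l - j.2 k).
      rewrite -eg => /f_inj inj.
      by have [-> -> ->] : (j, (l, k)) = (j', (l', k')) by apply: inj; [|rewrite eg]; apply: in_type.
    by move/not_opp.
  case: (ltngtP l' k') ne' => [lt' _|lt' _|/val_inj->]; last by rewrite eqxx.
    by move/esym/not_opp.
  have eg' : j.2 k - j.2 l = j'.2 k' - j'.2 l' by rewrite -opprB eg opprB.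
  have [_ f_inj _] := fP (j.2 k - j.2 l).
  rewrite -eg' => /oppr_inj/f_inj inj.
  by have [-> -> ->] : (j, (k, l)) = (j', (k', l')) by apply: inj; [|rewrite eg']; apply: in_type.
Qed.

Variable K : {fset nat}.
Hypothesis K_pos : forall k, k \in K -> (0 < k)%N.
Hypothesis H_K : #|H| \in K.
Hypothesis kappa_K : forall i, kappa i \in K.
Hypothesis K_kappa : forall k, k \in K -> k = #|H| \/ exists i, kappa i = k.

(** Take for S the kernel of the [m]-th power: nonzero elements with equal [m]-th powers differ by a
    factor in S, so the statements on residues become the transversal conditions of the
    construction. *)
Lemma harmonious_of_pattern : harmonious_exists K (#|H| * #|F|).
Proof.
have m_gt0 : (0 < m)%N by case: m m_odd.
have [b [ex nz uq dex duq]] := pattern_embedding.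
pose S := [set s : F | s ^+ m == 1].
have S_neq0 s : s \in S -> s != 0.
  by rewrite inE; apply: contraTneq => ->; rewrite expr0n gtn_eqF // eq_sym oner_eq0.
have chiS s x : s \in S -> (s * x) ^+ m = x ^+ m.
  by rewrite inE exprMn => /eqP->; rewrite mul1r.
have quot x z : z != 0 -> x ^+ m = z ^+ m -> z / x \in S /\ z / x * x = z.
  move=> z0 exz; have x0 : x != 0.
    apply: contraNneq z0 => x0; have := expf_eq0 z m.
    by rewrite -exz x0 expr0n gtn_eqF // eqxx m_gt0 /= => <-.
  by rewrite inE expr_div_n exz divff ?expf_neq0 // divfK.
apply: (@harmonious_construction H F _ _ (slots kappa (n := n)) S (fun j l => j.2 l) b) => //.
- by rewrite inE expr1n.
- by move=> j l s lj sS; apply: mulf_neq0; [apply: S_neq0 | apply: nz].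
- move=> z z0; have [j [l [lj e]]] := ex z z0; have [sS e'] := quot _ _ z0 e.
  by exists j, l, (z / b j l).
- move=> j l s j' l' s' lj sS lj' sS' e.
  have [|ej el] := uq j l j' l' lj lj'; first by rewrite -(chiS s) // e chiS.
  by subst; split=> //; apply: mulIf e; apply: nz.
- move=> g z z0; have [j [l [l' [lj lj' _ eg e]]]] := dex g z z0.
  by have [sS e'] := quot _ _ z0 e; exists j, l, l', (z / (b j l - b j l')).
- move=> j l k s j' l' k' s' lj kj ne sS lj' kj' ne' sS' eg e.
  have [|ej el ek] := duq j l k j' l' k' lj kj ne lj' kj' ne' eg.
    by rewrite -(chiS s) // e chiS.
  (* The factor can be cancelled: distinct slots have distinct residues, hence distinct values of
     [b]. *)
  subst; split=> //; apply: mulIf e; rewrite subr_eq0.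
  by apply: contraNneq ne => eb; apply/eqP; case: (uq j' l' j' k') => //; rewrite eb.
- by move=> j; rewrite card_slots.
- move=> k /K_kappa[|[i <-]]; [by left | right].
  by exists (i, [ffun=> 0]); rewrite card_slots.
Qed.

End Assembly.

(** * Block sizes *)

(* The number of copies of h makes the sum of k (k - 1 - h) over the list
   vanish: each k in ks, taken h times, contributes h k (k - h - 1), and each h
   contributes - h. *)
Definition balanced_sizes (h : nat) (ks : seq nat) : seq nat :=
  nseq (\sum_(k <- ks) k * (k - h.+1)) h ++ flatten [seq nseq h k | k <- ks].

Lemma sum_balanced_sizes h ks (f : nat -> nat) :
  \sum_(k <- balanced_sizes h ks) f k =
  (\sum_(k <- ks) k * (k - h.+1)) * f h + h * \sum_(k <- ks) f k.
Proof.
rewrite big_cat big_flatten big_map big_nseq iter_addn_0 mulnC; congr addn.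
by rewrite big_distrr /=; apply: eq_bigr => k _; rewrite big_nseq iter_addn_0 mulnC.
Qed.

(** As [h < k], the subtraction [k - h.+1] is exact and [k (k - 1) = k (k - h - 1) + h k]. This
    identity yields the hypothesis [size_pairs]. *)
Lemma balanced_sizesP h ks : all (fun k => h < k) ks ->
  \sum_(k <- balanced_sizes h ks) k * k.-1 = h * \sum_(k <- balanced_sizes h ks) k.
Proof.
move=> /allP lt_ks; rewrite !sum_balanced_sizes.
have -> : \sum_(k <- ks) k * k.-1 = \sum_(k <- ks) k * (k - h.+1) + h * \sum_(k <- ks) k.
  rewrite big_distrr -big_split /=; apply: eq_big_seq => k /lt_ks lt.
  by rewrite (mulnC h) -mulnDr; congr muln; lia.
by case: h {lt_ks} => [|h]; nia.
Qed.

Lemma mem_balanced_sizes h ks k : 0 < h ->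
  k \in balanced_sizes h ks -> (k == h) || (k \in ks).
Proof.
move=> h_gt0; rewrite mem_cat mem_nseq => /orP[/andP[_ ->//]|].
by move=> /flattenP[_ /mapP[x xks ->]]; rewrite mem_nseq => /andP[_ /eqP->]; rewrite xks orbT.
Qed.

Lemma balanced_sizes_mem h ks k : 0 < h -> k \in ks -> k \in balanced_sizes h ks.
Proof.
move=> h_gt0 kks; rewrite mem_cat; apply/orP; right; apply/flattenP.
by exists (nseq h k); [apply: map_f | rewrite mem_nseq h_gt0 /=].
Qed.

(** * Choice of the block sizes, the index and the field *)

Unset Implicit Arguments.

Theorem theorem7p3 (K : {fset nat})
  (hK_pos : forall k : nat, k \in K -> 0 < k)
  (hK_card : 1 < #|` K|) :
  forall N : nat, exists v : nat, N < v /\ harmonious_exists K v.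
Proof.
move=> N.
have exK : exists k, k \in K.
  by apply/fset0Pn; rewrite -cardfs_gt0 ltnW.
(* The least size is a successor, so ['I_h'.+1] is a cyclic group of that order. *)
case: (ex_minnP exK) => [] [|h'] hK h_min; first by have := hK_pos 0 hK.
pose h := h'.+1; pose ks := [seq k <- enum_fset K | k != h].
have ksP k : (k \in ks) = (k != h) && (k \in K) by rewrite mem_filter.
have lt_ks : all (fun k => h < k) ks.
  by apply/allP=> k; rewrite ksP => /andP[ne /h_min]; rewrite leq_eqVlt eq_sym (negPf ne).
have [k1 k1ks] : exists k1, k1 \in ks.
  have /fset0Pn[k] : (K `\ h)%fset != fset0.
    by rewrite -cardfs_gt0; have := cardfsD1 h K; rewrite hK; lia.
  by rewrite in_fsetD1 => kP; exists k; rewrite ksP.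
pose l0 := balanced_sizes h ks.
have l0_sum : 0 < \sum_(k <- l0) k.
  have k1l0 : k1 \in l0 by apply: balanced_sizes_mem.
  rewrite (big_rem k1) //= addn_gt0; apply/orP; left.
  by have /allP/(_ _ k1ks) := lt_ks; apply: leq_trans.
(* The sum serves as a common upper bound for all sizes in [l0]. *)
pose n := \sum_(k <- l0) k.
have h_gt0 : 0 < h ^ n by rewrite expn_gt0.
have [|d [dvd_d d_even d_gt0 fields]] := @field_with_odd_index (h ^ n * \sum_(k <- l0) k).
  by rewrite muln_gt0 h_gt0.
(* Repeating the list [l0] this many times brings the number of points to exactly [d] and keeps the
   sizes balanced. *)
pose r := d %/ (h ^ n * \sum_(k <- l0) k).
have r_eq : r * (h ^ n * \sum_(k <- l0) k) = d by apply: divnK.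
have r_gt0 : 0 < r by move: d_gt0; rewrite -r_eq muln_gt0 => /andP[].
(* One bound serves both for [v > N] and for the greedy choice. *)
have [F [m [m_odd cardF two_neq0 F_big]]] :=
  fields (N + d * (4 * d ^ 2) * ((2 * d) ^ d * (2 * d)) ^ 2).
pose kappa (i : 'I_(size l0) * 'I_r) := nth 0 l0 i.1.
have sum_kappa (f : nat -> nat) : \sum_i f (kappa i) = r * \sum_(k <- l0) f k.
  rewrite -(pair_bigA _ (fun (i : 'I_(size l0)) (_ : 'I_r) => f (nth 0 l0 i))) (big_nth 0) big_mkord.
  by rewrite big_distrr; apply: eq_bigr => i _; rewrite sum_nat_const card_ord.
have kappa_mem i : kappa i \in l0 by apply: mem_nth.
exists (#|'I_h'.+1| * #|F|); split.
  by rewrite card_ord; apply: (leq_trans (leq_ltn_trans (leq_addr _ _) F_big)); rewrite leq_pmull.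
apply: (@harmonious_of_pattern _ _ kappa n _ F m d) => //; rewrite ?card_ord //.
- move=> i; rewrite /n (big_rem (kappa i)) //= leq_addr //.
- exact: leq_ltn_trans (leq_addl _ _) F_big.
- by rewrite (sum_kappa id) mulnCA.
- rewrite (sum_kappa id) (sum_kappa (fun k => k * k.-1)) mulnCA; congr muln.
  exact: balanced_sizesP.
- move=> i; have := mem_balanced_sizes (ltn0Sn h') (kappa_mem i).
  by case/orP => [/eqP->//|]; rewrite ksP => /andP[].
- move=> k kK; have [->|ne] := eqVneq k h; [by left | right].
  have kl0 : k \in l0 by apply: balanced_sizes_mem; rewrite ?ksP ?ne.
  have lt : index k l0 < size l0 by rewrite index_mem.
  by exists (Ordinal lt, Ordinal r_gt0); rewrite /kappa /= nth_index.
Qed.
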